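(* Let $A$ be the random matrix defined in the context, with parameters $r\le k$ and $D$ satisfying $r\to\infty$, $D/r^2\to\infty$ and $(\log k)/D\to 0$. Then there is an absolute constant $c$ such that with probability $1-o(1)$ over $A$: (i) $\lambda_\delta(A)\le 1$ for $\delta=c\sqrt{(\log k)/D}$; and (ii) for every algorithm $\mathcal{A}$ that receives a document of $m=o(r^2)$ words generated from an unknown $x^*\in\mathcal{S}_k$ and outputs a subset of $[k]$, there exists $x^*\in\mathcal{S}_k$ with at most $r$ nonzero entries, all of them at least $1/r$, such that $\mathcal A$ outputs $\mathrm{supp}(x^* )$ with probability less than $3/4$ (for all sufficiently large parameters).
   Context: Random instance: let $S_1,\dots,S_k\subseteq[D]$ be independent uniformly random subsets of $[D]$ (each element included independently with probability $1/2$), and let $A\in\mathbb{R}^{D\times k}$ have $A_{ij}=1/|S_j|$ if $i\in S_j$ and $A_{ij}=0$ otherwise. $\mathcal{S}_k=\{z\in\mathbb{R}^k_{\ge0}:\sum_iz_i=1\}$. A document of $m$ words generated from $x\in\mathcal{S}_k$ consists of $m$ words drawn i.i.d. from the categorical distribution on $[D]$ with probabilities $Ax$. For a matrix $M$, $\|M\|_{\max}=\max_{i,j}|M_{ij}|$; $\lambda_\delta(A)$ is the optimal value of: minimize $\|B\|_{\max}$ over $B\in\mathbb{R}^{k\times D}$ subject to $\|BA-I_k\|_{\max}\le\delta$. *)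

(* Defs.v *)
From Stdlib Require Import Reals ClassicalEpsilon.
From mathcomp Require Import all_boot.
Set Implicit Arguments. Unset Strict Implicit. Unset Printing Implicit Defensive.
Open Scope R_scope.

Definition rsum {T : finType} (F : T -> R) : R := \big[Rplus/R0]_(t : T) F t.
Definition rprod {T : finType} (F : T -> R) : R := \big[Rmult/R1]_(t : T) F t.

Definition indicator (P : Prop) : R :=
  if excluded_middle_informative P then 1 else 0.

(* A random instance: k subsets S_1..S_k of [D] (uniformly, i.e. each element
   included independently with prob 1/2 = uniform over this finite type). *)
Notation instance D k := {ffun 'I_k -> {set 'I_D}}.

Definition prob_inst (D k : nat) (E : instance D k -> Prop) : R :=
  rsum (fun S : instance D k => indicator (E S)) / INR #|{: instance D k}|.

Definition Amat (D k : nat) (S : instance D k) (i : 'I_D) (j : 'I_k) : R :=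
  if i \in S j then / INR #|S j| else 0.

Definition maxnorm (k D : nat) (B : 'I_k -> 'I_D -> R) : R :=
  \big[Rmax/R0]_(i : 'I_k) \big[Rmax/R0]_(l : 'I_D) Rabs (B i l).

Definition prodBA (D k : nat) (B : 'I_k -> 'I_D -> R) (A : 'I_D -> 'I_k -> R)
  (i j : 'I_k) : R := rsum (fun l : 'I_D => B i l * A l j).

Definition kron (k : nat) (i j : 'I_k) : R := if i == j then 1 else 0.

Definition lam_feasible (D k : nat) (A : 'I_D -> 'I_k -> R) (delta : R)
  (B : 'I_k -> 'I_D -> R) : Prop :=
  \big[Rmax/R0]_(i : 'I_k) \big[Rmax/R0]_(j : 'I_k)
     Rabs (prodBA B A i j - kron i j) <= delta.

Definition is_lambda (D k : nat) (A : 'I_D -> 'I_k -> R) (delta v : R) : Prop :=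
  (exists B, lam_feasible A delta B /\ maxnorm B = v) /\
  (forall B, lam_feasible A delta B -> v <= maxnorm B).

Definition in_simplex (k : nat) (x : 'I_k -> R) : Prop :=
  (forall j, 0 <= x j) /\ rsum x = 1.

Definition supp (k : nat) (x : 'I_k -> R) : {set 'I_k} :=
  [set j | if Req_dec_T (x j) 0 then false else true].

Notation document m D := {ffun 'I_m -> 'I_D}.

Definition doc_prob (m D k : nat) (A : 'I_D -> 'I_k -> R) (x : 'I_k -> R)
  (w : document m D) : R :=
  rprod (fun t : 'I_m => rsum (fun j : 'I_k => A (w t) j * x j)).

(* a (possibly randomized) algorithm: a probability distribution on subsets
   of [k] for each document; deterministic algorithms are the 0/1 ones *)
Definition is_algorithm (m D k : nat) (Alg : document m D -> {set 'I_k} -> R)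
  : Prop :=
  forall w, (forall s, 0 <= Alg w s) /\ rsum (Alg w) = 1.

Definition success_prob (m D k : nat) (A : 'I_D -> 'I_k -> R)
  (Alg : document m D -> {set 'I_k} -> R) (x : 'I_k -> R) : R :=
  rsum (fun w : document m D => doc_prob A x w * Alg w (supp x)).

Definition sparse_lb (k r : nat) (x : 'I_k -> R) : Prop :=
  (#|supp x| <= r)%N /\ (forall j, x j <> 0 -> / INR r <= x j).

Definition good_event (c : R) (r D k m : nat) (S : instance D k) : Prop :=
  (exists v, is_lambda (Amat S) (c * sqrt (ln (INR k) / INR D)) v /\ v <= 1) /\
  (forall Alg : document m D -> {set 'I_k} -> R, is_algorithm Alg ->
     exists x : 'I_k -> R, in_simplex x /\ sparse_lb r x /\
       success_prob (Amat S) Alg x < 3 / 4).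
Arguments good_event c r D k m S : clear implicits.

(* Main.v *)
(* (i) Take B with rows +1 on S_i and -1 off S_i: then (BA)_ii = 1, and (BA)_ij is
   the average over S_j of independent signs, so a Chernoff bound and a union
   bound make all off-diagonal entries O(sqrt (log k / D)).  The same argument
   gives |S_j| >= D/4 for all j.

   (ii) On the event that all |S_j| >= D/4 the bound is deterministic (Le Cam's
   two-point method).  Among r topics there are two, a and b, for which
   sum_i A_ia^2 / (sum_j A_ij) is O(1/r), since these quantities add up to at
   most sum_i max_j A_ij <= 4.  Compare the uniform mixture x2 of the r topics
   with x1 = x2 + (e_a - e_b)/r, whose support misses b: the chi-square
   divergence between one word of each is O(1/r^2), so m = o(r^2) words do not
   distinguish them. *)
Require Import Defs.
From HB Require Import structures.
From Stdlib Require Import Reals Lra Lia ClassicalEpsilon.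
From mathcomp Require Import all_boot zify.
Set Implicit Arguments. Unset Strict Implicit. Unset Printing Implicit Defensive.
Open Scope R_scope.

(** * Finite sums and products of reals *)

HB.instance Definition _ := Monoid.isComLaw.Build R R0 Rplus
  (fun x y z => esym (Rplus_assoc x y z)) Rplus_comm Rplus_0_l.
HB.instance Definition _ := Monoid.isComLaw.Build R R1 Rmult
  (fun x y z => esym (Rmult_assoc x y z)) Rmult_comm Rmult_1_l.
HB.instance Definition _ := Monoid.isMulLaw.Build R R0 Rmult
  Rmult_0_l Rmult_0_r.
HB.instance Definition _ := Monoid.isAddLaw.Build R Rmult Rplus
  Rmult_plus_distr_r Rmult_plus_distr_l.

Section FiniteSums.
Variable T : finType.
Implicit Types F G : T -> R.

Lemma eq_rsum F G : F =1 G -> rsum F = rsum G.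
Proof. by move=> FG; apply: eq_bigr => t _. Qed.

Lemma rsum_le F G : (forall t, F t <= G t) -> rsum F <= rsum G.
Proof.
move=> FG; apply: (big_ind2 Rle) => [|x1 x2 y1 y2|//]; first exact: Rle_refl.
exact: Rplus_le_compat.
Qed.

Lemma rsum_const (c : R) : rsum (fun _ : T => c) = INR #|T| * c.
Proof.
rewrite /rsum big_const; elim: #|T| => [|n IH]; first by rewrite /=; lra.
rewrite iterS IH S_INR; lra.
Qed.

Lemma rsum_ge0 F : (forall t, 0 <= F t) -> 0 <= rsum F.
Proof. by move=> /rsum_le; rewrite rsum_const Rmult_0_r. Qed.

Lemma rsumD F G : rsum (fun t => F t + G t) = rsum F + rsum G.
Proof. exact: big_split. Qed.

Lemma rsumMl (c : R) F : rsum (fun t => c * F t) = c * rsum F.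
Proof. by rewrite /rsum big_distrr. Qed.

Lemma rsumMr (c : R) F : rsum (fun t => F t * c) = rsum F * c.
Proof. by rewrite /rsum big_distrl. Qed.

Lemma rsumB F G : rsum (fun t => F t - G t) = rsum F - rsum G.
Proof.
transitivity (rsum (fun t => F t + (-1) * G t)); first by apply: eq_rsum => t; lra.
rewrite rsumD rsumMl; lra.
Qed.

Lemma rsum_ge_term F (t : T) : (forall t, 0 <= F t) -> F t <= rsum F.
Proof.
move=> F0; rewrite /rsum (bigD1 t) //=.
suff : 0 <= \big[Rplus/R0]_(i | i != t) F i by lra.
by apply: big_ind => // [|x y]; lra.
Qed.

Lemma rsum_ge_pair F (t u : T) : u != t -> (forall t, 0 <= F t) ->
  F t + F u <= rsum F.
Proof.
move=> ut F0; rewrite /rsum (bigD1 t) //= (bigD1 u) //=.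
suff : 0 <= \big[Rplus/R0]_(i | (i != t) && (i != u)) F i by lra.
by apply: big_ind => // [|x y]; lra.
Qed.

Lemma rsum_mem (A : {set T}) :
  rsum (fun t => if t \in A then 1 else 0) = INR #|A|.
Proof.
rewrite /rsum -big_mkcond big_const; elim: #|A| => [//|n IH].
by rewrite iterS IH S_INR Rplus_comm.
Qed.

Lemma rprod_ge0 F : (forall t, 0 <= F t) -> 0 <= rprod F.
Proof.
by move=> F0; apply: big_ind => // [|x y]; [lra | exact: Rmult_le_pos].
Qed.

Lemma rprod_le F G : (forall t, 0 <= F t <= G t) -> rprod F <= rprod G.
Proof.
move=> FG; suff: 0 <= rprod F <= rprod G by case.
apply: (big_ind2 (fun x y => 0 <= x <= y)) => [|x1 x2 y1 y2 [? ?] [? ?]|//].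
  by lra.
by split; [exact: Rmult_le_pos | exact: Rmult_le_compat].
Qed.

Lemma rprod_const (c : R) : rprod (fun _ : T => c) = c ^ #|T|.
Proof. by rewrite /rprod big_const; elim: #|T| => [//|n IH]; rewrite iterS IH. Qed.

Lemma rprodM F G : rprod (fun t => F t * G t) = rprod F * rprod G.
Proof. exact: big_split. Qed.

Lemma rsum_delta F (t : T) : rsum (fun s => if s == t then F s else 0) = F t.
Proof. by rewrite /rsum -big_mkcond big_pred1_eq. Qed.

Lemma exists_le_mean (A : {set T}) F (M : R) : A != set0 ->
  (forall t, 0 <= F t) -> rsum F <= M ->
  exists2 a, a \in A & INR #|A| * F a <= M.
Proof.
move=> /set0Pn [a0 a0A] F0 FM.
have [//|none] := excluded_middle_informative (exists2 a, a \in A & INR #|A| * F a <= M).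
have big a : a \in A -> M < INR #|A| * F a.
  by move=> aA; apply: Rnot_le_lt => le; apply: none; exists a.
have Apos : 0 < INR #|A|.
  by apply: lt_0_INR; apply/ltP/card_gt0P; exists a0.
have e : INR #|A| * (M / INR #|A|) = M by field; lra.
have lt0 := big _ a0A.
(* The comparison function is [M / INR #|A|] on [A], except at [a0], where it is [F a0]; the excess
   there makes its sum strictly larger than [M]. *)
have : rsum (fun t => (if t \in A then 1 else 0) * (M / INR #|A|) +
    (if t == a0 then F t - M / INR #|A| else 0)) <= rsum F.
  apply: rsum_le => t; case: (eqVneq t a0) => [->|_]; first by rewrite a0A; lra.
  case: ifP => [tA|_]; last by rewrite Rmult_0_l; have := F0 t; lra.
  have := big _ tA => h; suff: M / INR #|A| <= F t by lra.
  by apply: (Rmult_le_reg_l _ _ _ Apos); lra.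
rewrite rsumD rsumMr rsum_mem rsum_delta => h.
nra.
Qed.

End FiniteSums.

Lemma rsum_ord_le (n : nat) (F : 'I_n -> R) (c : R) :
  (forall i, F i <= c) -> rsum F <= INR n * c.
Proof. by move=> /rsum_le; rewrite rsum_const card_ord. Qed.

Lemma exchange_rsum (T U : finType) (F : T -> U -> R) :
  rsum (fun t => rsum (F t)) = rsum (fun u => rsum (F^~ u)).
Proof. exact: exchange_big. Qed.

Lemma rsum_rprod (I J : finType) (F : I -> J -> R) :
  rsum (fun f : {ffun I -> J} => rprod (fun i => F i (f i))) =
  rprod (fun i => rsum (F i)).
Proof. by rewrite /rsum /rprod bigA_distr_bigA. Qed.

Lemma INR_expn (b n : nat) : INR (b ^ n) = INR b ^ n.
Proof. by elim: n => [|n IH] //; rewrite expnS -multE mult_INR IH. Qed.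

Lemma indicator_true (P : Prop) : P -> indicator P = 1.
Proof. by rewrite /indicator; case: (excluded_middle_informative P). Qed.

Lemma indicator_false (P : Prop) : ~ P -> indicator P = 0.
Proof. by rewrite /indicator; case: (excluded_middle_informative P). Qed.

Lemma indicator_ge0 (P : Prop) : 0 <= indicator P.
Proof. rewrite /indicator; case: (excluded_middle_informative P) => ? /=; lra. Qed.

Lemma indicator_le (P : Prop) (x : R) : 0 <= x -> (P -> 1 <= x) -> indicator P <= x.
Proof. by rewrite /indicator => x0 Px; case: (excluded_middle_informative P). Qed.

(** * A Chernoff bound for uniformly random subsets *)

(* Since 1 + y <= exp y, one has cosh x <= 1 / (1 - x^2) <= 1 + 2 x^2 when
   x^2 <= 1/2, and cosh x <= exp |x| <= exp (2 x^2) otherwise. *)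
Lemma exp_add_opp_le (x : R) : exp x + exp (- x) <= 2 * exp (2 * x ^ 2).
Proof.
have [le|gt] := Rle_lt_dec (x ^ 2) (1 / 2).
  have e1 := exp_ineq1_le x; have e2 := exp_ineq1_le (- x).
  have e12 : exp x * exp (- x) = 1 by rewrite -exp_plus Rplus_opp_r exp_0.
  have e3 := exp_ineq1_le (2 * x ^ 2).
  have x1 : -1 < x < 1 by nra.
  have b1 : exp x * (1 - x) <= 1 by have := exp_pos x; nra.
  have b2 : exp (- x) * (1 + x) <= 1 by have := exp_pos (- x); nra.
  have b3 : (exp x + exp (- x)) * (1 - x ^ 2) <= 2 by nra.
  have p1 := exp_pos x; have p2 := exp_pos (- x).
  nra.
have mono (y : R) : y <= 2 * x ^ 2 -> exp y <= exp (2 * x ^ 2).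
  by move=> [lt|->]; [left; exact: exp_increasing | right].
have m1 : exp x <= exp (2 * x ^ 2) by apply: mono; nra.
have m2 : exp (- x) <= exp (2 * x ^ 2) by apply: mono; nra.
lra.
Qed.

Definition sgn (T : finType) (A : {set T}) (t : T) : R := if t \in A then 1 else -1.

(** Memberships of distinct points are independent: expanding the product chooses, for each [t],
    whether [t] lies in [A]. *)
Lemma rsum_exp_sgn (T : finType) (w : T -> R) :
  rsum (fun A : {set T} => exp (rsum (fun t => w t * sgn A t))) =
  rprod (fun t => exp (w t) + exp (- w t)).
Proof.
rewrite /rprod bigA_distr; apply: eq_bigr => A _.
rewrite (big_morph exp exp_plus exp_0); apply: eq_bigr => t _.
by rewrite /sgn; case: ifP => _; congr exp; lra.
Qed.

Lemma exp_nat_mul (n : nat) (x : R) : exp (INR n * x) = exp x ^ n.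
Proof.
elim: n => [|n IH]; first by rewrite Rmult_0_l exp_0.
by rewrite S_INR Rmult_plus_distr_r Rmult_1_l exp_plus IH /= Rmult_comm.
Qed.

Lemma exp_le (x y : R) : x <= y -> exp x <= exp y.
Proof. by case=> [lt|->]; [left; exact: exp_increasing | right]. Qed.

(** Exponential Markov inequality: the indicator is at most the exponential of [lam] times the
    excess over [a], and the total of these factorises. The factors [2] from [exp_add_opp_le]
    multiply to the number of subsets. *)
Lemma chernoff_sgn (T : finType) (w : T -> R) (a : R) :
  (0 < #|T|)%N -> (forall t, -1 <= w t <= 1) -> 0 <= a ->
  rsum (fun A : {set T} => indicator (a <= rsum (fun t => w t * sgn A t))) <=
  exp (- (a ^ 2 / (8 * INR #|T|))) * INR #|{: {set T}}|.
Proof.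
move=> T0 w1 a0.
have n0 : 0 < INR #|T| by apply: lt_0_INR; apply/ltP.
(* This [lam] minimises [- lam * a + 2 * n * lam ^ 2], with value [- a ^ 2 / (8 * n)]. *)
set n := INR #|T| in n0 *; pose lam := a / (4 * n).
have lam0 : 0 <= lam by apply: Rmult_le_pos => //; left; apply: Rinv_0_lt_compat; lra.
have h1 : rsum (fun A : {set T} => indicator (a <= rsum (fun t => w t * sgn A t)))
  <= rsum (fun A : {set T} => exp (- (lam * a)) *
      exp (rsum (fun t => (lam * w t) * sgn A t))).
  apply: rsum_le => A; rewrite -exp_plus; apply: indicator_le.
    by left; exact: exp_pos.
  have -> : rsum (fun t => lam * w t * sgn A t) = lam * rsum (fun t => w t * sgn A t).
    by rewrite -rsumMl; apply: eq_rsum => t; rewrite Rmult_assoc.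
  move=> ge; rewrite -{1}exp_0; apply: exp_le; nra.
apply: (Rle_trans _ _ _ h1); rewrite rsumMl rsum_exp_sgn.
have h2 : rprod (fun t => exp (lam * w t) + exp (- (lam * w t))) <=
    rprod (fun _ : T => 2 * exp (2 * lam ^ 2)).
  apply: rprod_le => t; split.
    by have := exp_pos (lam * w t); have := exp_pos (- (lam * w t)); lra.
  apply: (Rle_trans _ _ _ (exp_add_opp_le _)).
  apply: Rmult_le_compat_l; first lra.
  apply: exp_le; have ww := w1 t.
  have ww2 : w t ^ 2 <= 1 by nra.
  have := pow2_ge_0 lam; rewrite Rpow_mult_distr; nra.
rewrite rprod_const in h2.
have -> : INR #|{: {set T}}| = 2 ^ #|T| 
  by have := card_powerset [set: T]; rewrite powersetT !cardsT => ->; rewrite INR_expn.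
apply: (Rle_trans _ _ _ (Rmult_le_compat_l _ _ _ (Rlt_le _ _ (exp_pos _)) h2)).
rewrite Rpow_mult_distr -exp_nat_mul -/n.
have -> : exp (- (a ^ 2 / (8 * n))) = exp (- (lam * a)) * exp (n * (2 * lam ^ 2)).
  by rewrite -exp_plus; congr exp; rewrite /lam; field; lra.
lra.
Qed.

(** * Resampling one coordinate *)

Section Resample.
Variables I J : finType.

Definition upd (f : {ffun I -> J}) (i : I) (t : J) : {ffun I -> J} :=
  [ffun j => if j == i then t else f j].

(** Swapping the fresh value [t] with the old value [f i] is an involution on pairs, so resampling a
    coordinate preserves the uniform distribution. *)
Lemma rsum_resample (i : I) (G : {ffun I -> J} -> R) :
  rsum (fun f => rsum (fun t => G (upd f i t))) = INR #|J| * rsum G.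
Proof.
pose h (p : {ffun I -> J} * J) := (upd p.1 i p.2, p.1 i).
have hK : involutive h.
  move=> [f t]; rewrite /h /= ffunE eqxx; congr (_, _).
  by apply/ffunP => j; rewrite !ffunE; case: eqP => // ->.
transitivity (rsum (fun p => G (h p).1)); first exact: pair_bigA.
transitivity (rsum (fun p : {ffun I -> J} * J => G p.1)).
  by rewrite /rsum [RHS](reindex_inj (inv_inj hK)).
transitivity (rsum (fun f => rsum (fun _ : J => G f))).
  by symmetry; exact: (pair_bigA _ (fun f _ => G f)).
by rewrite -rsumMl; apply: eq_rsum => f; rewrite rsum_const.
Qed.

(** Conditioning: a bound on the average with all coordinates but [i] fixed carries over to the full
    average. *)
Lemma rsum_resample_le (i : I) (G : {ffun I -> J} -> R) (b : R) :
  (0 < #|J|)%N ->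
  (forall f, rsum (fun t => G (upd f i t)) <= b * INR #|J|) ->
  rsum G <= b * INR #|{: {ffun I -> J}}|.
Proof.
move=> J0 le; have n0 : 0 < INR #|J| by apply: lt_0_INR; apply/ltP.
apply: (Rmult_le_reg_l _ _ _ n0); rewrite -(rsum_resample i).
apply: (Rle_trans _ _ _ (rsum_le le)); rewrite rsum_const; right.
by rewrite Rmult_comm (Rmult_comm b) Rmult_assoc.
Qed.

End Resample.

(** * Regular instances *)

(** The roles are asymmetric: [U] supplies the random signs, [V] the weights that are held fixed. *)
Definition signed_overlap (T : finType) (U V : {set T}) : R :=
  rsum (fun t => (if t \in V then 1 else 0) * sgn U t).

(* The signed overlap of [S i] and [S j] is [#|S j|] times the [(i, j)] entry
   of [B A] when [B] has rows [sgn (S i)]. *)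
Definition regular (D k : nat) (delta : R) (S : instance D k) : Prop :=
  (forall j, INR D <= 4 * INR #|S j|) /\
  (forall i j, i != j -> Rabs (signed_overlap (S i) (S j)) <= delta * INR D / 4).

Lemma card_sets_gt0 (T : finType) : (0 < #|{: {set T}}|)%N.
Proof. by apply/card_gt0P; exists set0. Qed.

(** The sum equals [#|T| - 2 * #|A|], so a small set is a large deviation of its signs. *)
Lemma small_set_sgn (T : finType) (A : {set T}) : 4 * INR #|A| < INR #|T| ->
  INR #|T| / 2 <= rsum (fun t => -1 * sgn A t).
Proof.
have -> : rsum (fun t => -1 * sgn A t) =
    rsum (fun t => 1 + (-2) * (if t \in A then 1 else 0)).
  by apply: eq_rsum => t; rewrite /sgn; case: ifP => _; lra.
by rewrite rsumD rsumMl rsum_mem rsum_const; lra.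
Qed.

Section Regularity.
Variables D k : nat.
Hypothesis D_gt0 : (0 < D)%N.

(** The weights may depend on the other sets of the instance; their invariance under [upd] at [i]
    lets [chernoff_sgn] apply with those sets fixed. *)
Lemma chernoff_instance (i : 'I_k) (w : instance D k -> 'I_D -> R) (a : R) :
  (forall S T l, w (upd S i T) l = w S l) ->
  (forall S l, -1 <= w S l <= 1) -> 0 <= a ->
  rsum (fun S => indicator (a <= rsum (fun l => w S l * sgn (S i) l))) <=
  exp (- (a ^ 2 / (8 * INR D))) * INR #|{: instance D k}|.
Proof.
move=> wS w1 a0; apply: (rsum_resample_le (i := i)) => [|S].
  exact: card_sets_gt0.
have := @chernoff_sgn _ (w S) a; rewrite card_ord => /(_ D_gt0 (w1 S) a0).
apply: Rle_trans; right; apply: eq_rsum => T; congr indicator; congr (_ <= _).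
by apply: eq_rsum => l; rewrite wS ffunE eqxx.
Qed.

Lemma prob_small_set (i : 'I_k) :
  rsum (fun S : instance D k => indicator (4 * INR #|S i| < INR D)) <=
  exp (- (INR D / 32)) * INR #|{: instance D k}|.
Proof.
have D0 : 0 < INR D by apply: lt_0_INR; apply/ltP.
have := @chernoff_instance i (fun _ _ => -1) (INR D / 2).
have -> : (INR D / 2) ^ 2 / (8 * INR D) = INR D / 32 by field; lra.
move=> H; apply: Rle_trans (H _ _ _) => [|//|*|]; [|split; lra|lra].
apply: rsum_le => S; apply: indicator_le => [|lt]; first exact: indicator_ge0.
rewrite indicator_true; first exact: Rle_refl.
by have := @small_set_sgn _ (S i); rewrite card_ord; apply.
Qed.

(** The weights come from [S j] with [j != i], hence are independent of [S i]; [e = 1] and [e = -1]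
    give the two tails. *)
Lemma prob_overlap (i j : 'I_k) (e a : R) : i != j -> -1 <= e <= 1 -> 0 <= a ->
  rsum (fun S : instance D k => indicator (a <= e * signed_overlap (S i) (S j))) <=
  exp (- (a ^ 2 / (8 * INR D))) * INR #|{: instance D k}|.
Proof.
move=> ij e1 a0.
have := @chernoff_instance i (fun S l => e * if l \in S j then 1 else 0) a.
move=> H; apply: Rle_trans (H _ _ _) => [|S T l|S l|//].
- right; apply: eq_rsum => S; congr indicator; congr (_ <= _).
  by rewrite -rsumMl; apply: eq_rsum => l; rewrite Rmult_assoc.
- by rewrite ffunE eq_sym (negbTE ij).
- by case: ifP => _; lra.
Qed.

Lemma not_regular (delta : R) (S : instance D k) : ~ regular delta S ->
  (exists i, 4 * INR #|S i| < INR D) \/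
  (exists i j, i != j /\ (delta * INR D / 4 <= 1 * signed_overlap (S i) (S j) \/
                         delta * INR D / 4 <= -1 * signed_overlap (S i) (S j))).
Proof.
move=> nreg; apply: NNPP => none; apply: nreg; split => [j|i j ij].
  by apply: Rnot_lt_le => lt; apply: none; left; exists j.
apply: Rnot_lt_le => lt; apply: none; right; exists i, j; split=> //.
by move: lt; rewrite /Rabs; case: Rcase_abs => _ lt; [right | left]; lra.
Qed.

(** Union bound over [k] small sets and at most [k ^ 2] pairs with two tails each; the deviation
    [a = delta * D / 4] has exponent [a ^ 2 / (8 * D) = delta ^ 2 * D / 128]. *)
Lemma prob_not_regular (delta : R) : 0 <= delta ->
  rsum (fun S : instance D k => indicator (~ regular delta S)) <=
  (INR k * exp (- (INR D / 32)) +
   2 * INR k ^ 2 * exp (- (delta ^ 2 * INR D / 128))) * INR #|{: instance D k}|.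
Proof.
move=> delta0; have D0 : 0 < INR D by apply: lt_0_INR; apply/ltP.
set a := delta * INR D / 4; set N := INR #|_|.
have a0 : 0 <= a by rewrite /a; nra.
pose small S i := indicator (4 * INR #|(S : instance D k) i| < INR D).
(* The diagonal is set to 0 so that the double sums can run over all pairs. *)
pose over e (S : instance D k) (i j : 'I_k) :=
  if i == j then 0 else indicator (a <= e * signed_overlap (S i) (S j)).
have small0 S i : 0 <= small S i by exact: indicator_ge0.
have over0 e S i j : 0 <= over e S i j.
  by rewrite /over; case: eqP => _; [right | exact: indicator_ge0].
have overs0 e S : 0 <= rsum (fun i => rsum (over e S i)).
  by apply: rsum_ge0 => i; exact: rsum_ge0.
apply: (@Rle_trans _ (rsum (fun S => rsum (small S) +
  (rsum (fun i => rsum (over 1 S i)) + rsum (fun i => rsum (over (-1) S i)))))).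
  apply: rsum_le => S; have s0 := rsum_ge0 (small0 S).
  have o1 := overs0 1 S; have o2 := overs0 (-1) S.
  apply: indicator_le => [|/not_regular]; first lra.
  have overs_ge e (i j : 'I_k) : i != j -> a <= e * signed_overlap (S i) (S j) ->
      1 <= rsum (fun i => rsum (over e S i)).
    move=> ij le; have -> : 1 = over e S i j by rewrite /over (negbTE ij) indicator_true.
    apply: Rle_trans (rsum_ge_term j (over0 e S i)) _.
    by apply: (rsum_ge_term (F := fun i => rsum (over e S i))) => i'; exact: rsum_ge0.
  case=> [[i lt]|[i [j [ij [le|le]]]]].
  - have : small S i <= rsum (small S) by exact: rsum_ge_term.
    by rewrite /small indicator_true //; lra.
  - by have := overs_ge _ _ _ ij le; lra.
  - by have := overs_ge _ _ _ ij le; lra.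
rewrite !rsumD exchange_rsum.
have overs_le e : -1 <= e <= 1 ->
    rsum (fun S => rsum (fun i => rsum (over e S i))) <=
    INR k * (INR k * (exp (- (delta ^ 2 * INR D / 128)) * N)).
  move=> e1; rewrite exchange_rsum; apply: rsum_ord_le => i.
  rewrite exchange_rsum; apply: rsum_ord_le => j; rewrite /over; case: eqVneq => [_|ij].
    rewrite rsum_const Rmult_0_r; apply: Rmult_le_pos; last exact: pos_INR.
    by left; exact: exp_pos.
  have -> : delta ^ 2 * INR D / 128 = a ^ 2 / (8 * INR D) by rewrite /a; field; lra.
  exact: prob_overlap.
have : rsum (fun i => rsum (small^~ i)) <= INR k * (exp (- (INR D / 32)) * N).
  by apply: rsum_ord_le => i; exact: prob_small_set.
have := overs_le 1 ltac:(lra); have := overs_le (-1) ltac:(lra); nra.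
Qed.

End Regularity.

(** * Attainment of the optimum *)

Lemma Un_cv_const (c : R) : Un_cv (fun _ => c) c.
Proof. by move=> e e0; exists 0%N => n _; rewrite Rdist_eq. Qed.

Lemma Un_cv_subseq (u : nat -> R) (l : R) (phi : nat -> nat) :
  (forall n, (n <= phi n)%N) -> Un_cv u l -> Un_cv (fun n => u (phi n)) l.
Proof.
move=> phin ul e e0; have [N uN] := ul e e0; exists N => n nN.
by apply: uN; have /leP := phin n; lia.
Qed.

Lemma Un_cv_rsum (T : finType) (u : T -> nat -> R) (l : T -> R) :
  (forall t, Un_cv (u t) (l t)) -> Un_cv (fun n => rsum (u^~ n)) (rsum l).
Proof.
move=> ul; rewrite /rsum; elim: (index_enum T) => [|t s IH].
  by apply: (Un_cv_ext (fun _ => 0)) => [n|]; rewrite big_nil //; exact: Un_cv_const.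
rewrite big_cons; apply: (Un_cv_ext _ _ _ _ (CV_plus _ _ _ _ (ul t) IH)) => n.
by rewrite big_cons.
Qed.

Lemma Un_cv_Rabs_le (u v : nat -> R) (l c : R) :
  (forall n, Rabs (u n) <= v n) -> Un_cv u l -> Un_cv v c -> Rabs l <= c.
Proof. by move=> uv /cv_cvabs ul vc; exact: Rle_cv_lim uv ul vc. Qed.

(** Terms of arbitrarily large index come close to a cluster point. The condition [n <= phi n]
    stands in for monotonicity and is enough to preserve limits. *)
Lemma bounded_convergent_subseq (u : nat -> R) (M : R) :
  (forall n, Rabs (u n) <= M) ->
  exists (phi : nat -> nat) (l : R),
    (forall n, (n <= phi n)%N) /\ Un_cv (fun n => u (phi n)) l.
Proof.
move=> uM; have [|l lP] := Bolzano_Weierstrass u _ (compact_P3 (- M) M).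
  by move=> n; have := uM n; split_Rabs; lra.
have step n : exists p, (n <= p)%N /\ Rabs (u p - l) < RinvN n.
  have [|p [/leP np lt]] := lP (disc l (RinvN n)) n; last by exists p.
  by exists (RinvN n).
pose phi n := proj1_sig (constructive_indefinite_description _ (step n)).
have phiP n : (n <= phi n)%N /\ Rabs (u (phi n) - l) < RinvN n.
  exact: (proj2_sig (constructive_indefinite_description _ (step n))).
exists phi, l; split=> [n|e e0]; first by case: (phiP n).
have [N RN] := RinvN_cv e0; exists N => n nN; have [_ lt] := phiP n.
apply: Rlt_trans lt _; have := RN n nN; rewrite /Rdist Rminus_0_r.
exact: Rle_lt_trans (Rle_abs _).
Qed.

(** Subsequences are extracted for one index at a time; later extractions preserve the earlier
    limits. *)
Lemma common_convergent_subseq (T : finType) (u : T -> nat -> R) (M : R) :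
  (forall t n, Rabs (u t n) <= M) ->
  exists (phi : nat -> nat) (l : T -> R),
    (forall n, (n <= phi n)%N) /\ forall t, Un_cv (fun n => u t (phi n)) (l t).
Proof.
move=> uM.
have [phi [l [phin cv]]] : exists (phi : nat -> nat) (l : T -> R),
    (forall n, (n <= phi n)%N) /\
    forall t, t \in enum T -> Un_cv (fun n => u t (phi n)) (l t).
  elim: (enum T) => [|t s [phi [l [phin cv]]]]; first by exists id, (fun _ => 0).
  have [psi [lt [psin cvt]]] := bounded_convergent_subseq (fun n => uM t (phi n)).
  exists (phi \o psi), (fun t' => if t' == t then lt else l t').
  split=> [n|t']; first exact: leq_trans (psin n) (phin _).
  rewrite inE; case: eqVneq => [->//|_ /= /cv]; exact: Un_cv_subseq.
by exists phi, l; split=> // t; apply: cv; rewrite mem_enum.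
Qed.

(** The fold starts from [R0], whence the hypothesis on [v]. *)
Lemma bigRmax_le (T : finType) (F : T -> R) (v : R) : 0 <= v ->
  \big[Rmax/R0]_(t : T) F t <= v <-> forall t, F t <= v.
Proof.
move=> v0; split=> [le t|le].
  apply: Rle_trans le; have := mem_index_enum t.
  elim: (index_enum T) => [//|t' s IH]; rewrite inE big_cons => /orP [/eqP <-|/IH le].
    exact: Rmax_l.
  exact: Rle_trans le (Rmax_r _ _).
by apply: (big_ind (fun x => x <= v)) => // x y; exact: Rmax_lub.
Qed.

Lemma maxnorm_le (k D : nat) (B : 'I_k -> 'I_D -> R) (v : R) : 0 <= v ->
  maxnorm B <= v <-> forall i l, Rabs (B i l) <= v.
Proof.
move=> v0; rewrite /maxnorm bigRmax_le //; split=> le i.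
  by apply/bigRmax_le => //; exact: le.
by apply/bigRmax_le.
Qed.

Lemma maxnorm_ge0 (k D : nat) (B : 'I_k -> 'I_D -> R) : 0 <= maxnorm B.
Proof.
apply: (big_rec (fun x => 0 <= x)) => [|i x _ x0]; first exact: Rle_refl.
exact: Rle_trans x0 (Rmax_r _ _).
Qed.

Lemma lam_feasibleP (D k : nat) (A : 'I_D -> 'I_k -> R) delta B : 0 <= delta ->
  lam_feasible A delta B <-> forall i j, Rabs (prodBA B A i j - kron i j) <= delta.
Proof.
move=> delta0; rewrite /lam_feasible bigRmax_le //; split=> le i.
  by apply/bigRmax_le => //; exact: le.
by apply/bigRmax_le.
Qed.

(** Compactness: near-optimal feasible matrices have uniformly bounded entries, so a subsequence
    converges entrywise, and the constraints and the norm bound pass to the limit. *)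
Lemma is_lambda_exists (D k : nat) (A : 'I_D -> 'I_k -> R) (delta : R) :
  0 <= delta -> (exists B, lam_feasible A delta B) -> exists v, is_lambda A delta v.
Proof.
move=> delta0 [B0 B0P].
(* [completeness] provides suprema, so the infimum appears as [- s], with [s] the supremum of the
   negated norms. *)
pose E x := exists B, lam_feasible A delta B /\ x = - maxnorm B.
have [||s [ub lub]] := completeness E.
- by exists 0 => x [B [_ ->]]; have := maxnorm_ge0 B; lra.
- by exists (- maxnorm B0), B0.
have lb B : lam_feasible A delta B -> - s <= maxnorm B.
  by move=> BP; have : - maxnorm B <= s by [apply: ub; exists B]; lra.
have s0 : 0 <= - s.
  have : s <= 0 by [apply: lub => x [B [_ ->]]; have := maxnorm_ge0 B; lra]; lra.
have step n : exists B, lam_feasible A delta B /\ maxnorm B <= - s + RinvN n.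
  apply: NNPP => none; have := cond_pos (RinvN n) => n0.
  suff : s <= s - RinvN n by lra.
  apply: lub => x [B [BP ->]]; apply: Rnot_lt_le => lt; apply: none.
  by exists B; split=> //; lra.
pose Bn n := proj1_sig (constructive_indefinite_description _ (step n)).
have BnP n : lam_feasible A delta (Bn n) /\ maxnorm (Bn n) <= - s + RinvN n.
  exact: (proj2_sig (constructive_indefinite_description _ (step n))).
have RinvN1 n : RinvN n <= 1.
  rewrite -Rinv_1; apply: Rinv_le_contravar; first lra.
  by have := pos_INR n; lra.
have Bn_le n i l : Rabs (Bn n i l) <= - s + RinvN n.
  have [_ /maxnorm_le] := BnP n; apply.
  by have := cond_pos (RinvN n); lra.
have [|phi [l [phin cv]]] := @common_convergent_subseq
    ('I_k * 'I_D)%type (fun t n => Bn n t.1 t.2) (- s + 1).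
  by move=> t n; have := Bn_le n t.1 t.2; have := RinvN1 n; lra.
pose B i j := l (i, j).
have BP : lam_feasible A delta B.
  apply/lam_feasibleP => // i j.
  apply: (@Un_cv_Rabs_le (fun n => prodBA (Bn (phi n)) A i j - kron i j) (fun _ => delta)).
  - by move=> n; have [/lam_feasibleP le _] := BnP (phi n); exact: le.
  - apply: CV_minus; last exact: Un_cv_const.
    apply: Un_cv_rsum => t; apply: CV_mult; last exact: Un_cv_const.
    exact: (cv (i, t)).
  - exact: Un_cv_const.
exists (- s); split=> //; exists B; split=> //.
apply: Rle_antisym; last exact: lb.
apply/maxnorm_le => // i j.
apply: (@Un_cv_Rabs_le (fun n => Bn (phi n) i j) (fun n => - s + RinvN (phi n))).
- by move=> n; exact: Bn_le.
- exact: (cv (i, j)).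
- have := CV_plus _ _ _ _ (Un_cv_const (- s)) (Un_cv_subseq phin RinvN_cv).
  by rewrite Rplus_0_r.
Qed.

(** * The lower bound *)

Section LeCam.
Variables (m D k : nat) (A : 'I_D -> 'I_k -> R) (x1 x2 : 'I_k -> R).
Let p (x : 'I_k -> R) (i : 'I_D) : R := rsum (fun j => A i j * x j).
Hypothesis p1_ge0 : forall i, 0 <= p x1 i.
Hypothesis p2_ge0 : forall i, 0 <= p x2 i.
Hypothesis p2_sum : rsum (p x2) = 1.
Hypothesis p1_ac : forall i, p x2 i = 0 -> p x1 i = 0.

(** When [p x1] has total mass 1, this is one plus the chi-square divergence of [p x1] from [p x2];
    by independence, [m] words give [rho ^ m]. *)
Let rho : R := rsum (fun i => p x1 i ^ 2 / p x2 i).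

Lemma doc_prob_ge0 (x : 'I_k -> R) (w : document m D) :
  (forall i, 0 <= p x i) -> 0 <= doc_prob A x w.
Proof. by move=> p0; apply: rprod_ge0 => t; exact: p0. Qed.

Lemma ratio_ge0 (w : document m D) :
  0 <= rprod (fun t => p x1 (w t) ^ 2 / p x2 (w t)).
Proof.
apply: rprod_ge0 => t; have [lt|<-] := p2_ge0 (w t).
  by apply: Rmult_le_pos; [exact: pow2_ge_0 | left; exact: Rinv_0_lt_compat].
by rewrite /Rdiv Rinv_0; lra.
Qed.

(* Where P2 > 0 this is AM-GM, 2 sqrt (P2 * P1^2 / (4 P2)) = P1; where P2 = 0
   the ratio is 0 by Rocq's convention and P1 vanishes as well. *)
Lemma doc_prob_le (w : document m D) :
  doc_prob A x1 w <= doc_prob A x2 w +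
    rprod (fun t => p x1 (w t) ^ 2 / p x2 (w t)) / 4.
Proof.
have sq0 := ratio_ge0 w.
have P20 := doc_prob_ge0 w p2_ge0.
have e : doc_prob A x1 w ^ 2 =
    doc_prob A x2 w * rprod (fun t => p x1 (w t) ^ 2 / p x2 (w t)).
  rewrite /= Rmult_1_r /doc_prob -!rprodM; apply: eq_bigr => t _.
  rewrite -/(p x1 (w t)) -/(p x2 (w t)).
  have [/p1_ac ->|n0] := Req_dec (p x2 (w t)) 0; first by rewrite /Rdiv /=; ring.
  by field.
have P10 := doc_prob_ge0 w p1_ge0.
set q := rprod _ in sq0 e *.
have sq := pow2_ge_0 (doc_prob A x2 w - q / 4).
apply: Rsqr_incr_0_var; last lra.
by rewrite /Rsqr; nra.
Qed.

(** As the supports differ, the two correct outputs share probability at most 1 on each document.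
    Both document laws lie below [P2 + q / 4], whose total is [1 + rho ^ m / 4 < 3 / 2]; so one
    success probability is below half of that. *)
Lemma le_cam (Alg : document m D -> {set 'I_k} -> R) :
  is_algorithm Alg -> supp x1 != supp x2 -> rho ^ m < 2 ->
  success_prob A Alg x1 < 3 / 4 \/ success_prob A Alg x2 < 3 / 4.
Proof.
move=> algP ne rho2.
suff : success_prob A Alg x1 + success_prob A Alg x2 <= 1 + rho ^ m / 4 by lra.
have P2_sum : rsum (fun w : document m D => doc_prob A x2 w) = 1.
  by rewrite /doc_prob (rsum_rprod (fun _ i => p x2 i)) p2_sum rprod_const pow1.
have rho_sum : rsum (fun w : document m D =>
    rprod (fun t => p x1 (w t) ^ 2 / p x2 (w t))) = rho ^ m.
  by rewrite (rsum_rprod (fun _ i => p x1 i ^ 2 / p x2 i)) rprod_const card_ord.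
have -> : 1 + rho ^ m / 4 = rsum (fun w : document m D => doc_prob A x2 w +
    rprod (fun t => p x1 (w t) ^ 2 / p x2 (w t)) * / 4).
  by rewrite rsumD rsumMr P2_sum rho_sum.
rewrite -rsumD; apply: rsum_le => w.
have [Alg0 Alg1] := algP w.
have le1 : Alg w (supp x1) + Alg w (supp x2) <= 1.
  by rewrite -Alg1; apply: rsum_ge_pair; rewrite // eq_sym.
have := Alg0 (supp x1); have := Alg0 (supp x2).
have := doc_prob_le w; have := ratio_ge0 w; have := doc_prob_ge0 w p2_ge0.
set q := rprod _; set P1 := doc_prob A x1 w; set P2 := doc_prob A x2 w.
move: (Alg w (supp x1)) (Alg w (supp x2)) le1 => s1 s2 le1.
move=> P2_ge0 q_ge0 P1_le s2_ge0 s1_ge0.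
have : P1 * s1 <= (P2 + q / 4) * s1 by exact: Rmult_le_compat_r.
have : P2 * s2 <= (P2 + q / 4) * s2 by apply: Rmult_le_compat_r => //; lra.
have : (P2 + q / 4) * (s1 + s2) <= (P2 + q / 4) * 1 by apply: Rmult_le_compat_l => //; lra.
lra.
Qed.

End LeCam.

(** * The two mixtures that are hard to distinguish *)

Lemma suppP (k : nat) (x : 'I_k -> R) (j : 'I_k) : reflect (x j <> 0) (j \in supp x).
Proof. by rewrite inE; case: (Req_dec_T _ _) => h; constructor. Qed.

Section HardPair.
Variables (D k : nat) (A : 'I_D -> 'I_k -> R) (M : R) (U : {set 'I_k}).
Hypothesis A_bound : forall i j, 0 <= A i j <= M.
Hypothesis M_ge0 : 0 <= M.
Hypothesis A_sum : forall j, rsum (A^~ j) = 1.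

(** [s] is [#|U|] times the word distribution of the uniform mixture on [U], and [h j / #|U|] is the
    chi-square cost of changing the weight of topic [j] by [1 / #|U|]. *)
Let s (i : 'I_D) : R := rsum (fun j => if j \in U then A i j else 0).
Let h (j : 'I_k) : R := rsum (fun i => A i j ^ 2 / s i).

Let s_ge0 i : 0 <= s i.
Proof. by apply: rsum_ge0 => j; case: ifP => _; [case: (A_bound i j) | right]. Qed.

Let le_s i j : j \in U -> A i j <= s i.
Proof.
move=> jU; have := @rsum_ge_term _ (fun j => if j \in U then A i j else 0) j.
rewrite jU; apply => t; by case: ifP => _; [case: (A_bound i t) | right].
Qed.

Let div_ge0 x y : 0 <= x -> 0 <= y -> 0 <= x / y.
Proof.
move=> x0 [y0|<-]; last by rewrite /Rdiv Rinv_0; lra.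
by apply: Rmult_le_pos => //; left; exact: Rinv_0_lt_compat.
Qed.

Let inv_s_ge0 i : 0 <= / s i.
Proof. by have := @div_ge0 1 (s i) ltac:(lra) (s_ge0 i); rewrite /Rdiv Rmult_1_l. Qed.

Let h_ge0 j : 0 <= h j.
Proof. by apply: rsum_ge0 => i; apply: div_ge0; [exact: pow2_ge_0|]. Qed.

(** In row [i], [A i j ^ 2 <= M * A i j] and the entries over [U] sum to [s i], so the row
    contributes at most [M]. A general [V] allows one topic to be removed from [U]. *)
Let h_sum (V : {set 'I_k}) : V \subset U ->
  rsum (fun j => if j \in V then h j else 0) <= INR D * M.
Proof.
move=> /subsetP VU.
have -> : rsum (fun j => if j \in V then h j else 0) =
    rsum (fun j => rsum (fun i => if j \in V then A i j ^ 2 / s i else 0)).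
  apply: eq_rsum => j; case: ifP => // _.
  by rewrite rsum_const Rmult_0_r.
rewrite exchange_rsum; apply: rsum_ord_le => i.
apply: (@Rle_trans _ (rsum (fun j => (if j \in U then A i j else 0) * (M / s i)))).
  apply: rsum_le => j; have [A0 AM] := A_bound i j.
  case: ifP => [/VU jU|_].
    rewrite jU /= Rmult_1_r {1}/Rdiv Rmult_assoc; apply: Rmult_le_compat_l => //.
    exact: Rmult_le_compat_r (inv_s_ge0 i) AM.
  apply: Rmult_le_pos; first by case: ifP => _ //; right.
  exact: Rmult_le_pos M_ge0 (inv_s_ge0 i).
rewrite rsumMr -/(s i); have [s0|<-] := s_ge0 i; last lra.
by right; field; lra.
Qed.

(* The small values of h are reached on two distinct topics because sum_(j in U) h j
   is at most sum_i max_j A i j. *)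
Lemma exists_small_pair : (1 < #|U|)%N ->
  exists a b, [/\ a \in U, b \in U, a != b,
    INR #|U| * h a <= INR D * M & INR #|U|.-1 * h b <= INR D * M].
Proof.
move=> U1.
have hV_ge0 (V : {set 'I_k}) j : 0 <= (if j \in V then h j else 0).
  by case: ifP => _ //; right.
have small (V : {set 'I_k}) : V \subset U -> V != set0 ->
    exists2 a, a \in V & INR #|V| * h a <= INR D * M.
  move=> VU V0; have [a aV] := exists_le_mean V0 (hV_ge0 V) (h_sum VU).
  by rewrite aV; exists a.
have [||a aU ha] := small U; rewrite // -?card_gt0; first by lia.
have cardUa : #|U :\ a| = #|U|.-1 by have := cardsD1 a U; rewrite aU; lia.
have [||b] := small (U :\ a); rewrite ?subD1set // -?card_gt0 ?cardUa; first by lia.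
by rewrite 2!inE => /andP [ba bU] hb; exists a, b; rewrite eq_sym.
Qed.

Let n : R := INR #|U|.
(** For distinct [a] and [b] in [U], [shift] moves the weight of [b] onto [a], so every nonzero
    weight is still at least [/ n]. *)
Let unif (j : 'I_k) : R := if j \in U then / n else 0.
Let shift (a b : 'I_k) (j : 'I_k) : R :=
  unif j + (if j == a then / n else 0) - (if j == b then / n else 0).

Lemma sparse_unif : (0 < #|U|)%N ->
  [/\ in_simplex unif, sparse_lb #|U| unif & supp unif = U].
Proof.
move=> U0; have n0 : 0 < n by apply: lt_0_INR; apply/ltP.
have in0 := Rinv_0_lt_compat _ n0.
have suppE : supp unif = U.
  by apply/setP => j; apply/suppP/idP; rewrite /unif; case: ifP => // _; lra.
split=> //.
- split=> [j|]; first by rewrite /unif; case: ifP => _; lra.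
  rewrite (@eq_rsum _ _ (fun j => (if j \in U then 1 else 0) * / n)) => [|j].
    rewrite rsumMr rsum_mem; apply: (@Rinv_r n); lra.
  by rewrite /unif; case: ifP => _; lra.
- split=> [|j]; first by rewrite suppE.
  by rewrite /unif -/n; case: ifP => _; lra.
Qed.

Lemma sparse_shift a b : a \in U -> b \in U -> a != b ->
  [/\ in_simplex (shift a b), sparse_lb #|U| (shift a b) & b \notin supp (shift a b)].
Proof.
move=> aU bU ab; have U0 : (0 < #|U|)%N by apply/card_gt0P; exists a.
have n0 : 0 < n by apply: lt_0_INR; apply/ltP.
have in0 := Rinv_0_lt_compat _ n0.
have [[unif0 unif1] _ _] := sparse_unif U0.
have shift_or j : shift a b j = 0 \/ j \in U /\ / n <= shift a b j.
  rewrite /shift /unif; have [->|jb] := eqVneq j b.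
    by rewrite bU eq_sym (negbTE ab); left; lra.
  have [->|ja] := eqVneq j a; first by rewrite aU; right; split=> //; lra.
  by case: ifP => jU; [right; split=> //; lra | left; lra].
split.
- split=> [j|]; first by case: (shift_or j) => [->|[_]]; lra.
  rewrite /shift rsumB rsumD unif1 (rsum_delta (fun _ => / n)) (rsum_delta (fun _ => / n)).
  lra.
- split=> [|j n0j]; last by case: (shift_or j) => [//|[_]].
  apply: subset_leq_card; apply/subsetP => j /suppP.
  by case: (shift_or j) => // [[]].
- by apply/suppP; rewrite /shift /unif bU eqxx eq_sym (negbTE ab); case; lra.
Qed.

Lemma word_sum (x : 'I_k -> R) : rsum x = 1 ->
  rsum (fun i => rsum (fun j => A i j * x j)) = 1.
Proof.
move=> <-; rewrite exchange_rsum; apply: eq_rsum => j.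
by rewrite rsumMr A_sum Rmult_1_l.
Qed.

Lemma word_ge0 (x : 'I_k -> R) i : in_simplex x -> 0 <= rsum (fun j => A i j * x j).
Proof.
move=> [x0 _]; apply: rsum_ge0 => j; apply: Rmult_le_pos => //.
by case: (A_bound i j).
Qed.

Lemma word_unif i : rsum (fun j => A i j * unif j) = s i * / n.
Proof. by rewrite -rsumMr; apply: eq_rsum => j; rewrite /unif; case: ifP => _; lra. Qed.

Lemma word_shift a b i :
  rsum (fun j => A i j * shift a b j) = (s i + A i a - A i b) * / n.
Proof.
have -> : A i a = rsum (fun j => if j == a then A i j else 0) by rewrite rsum_delta.
have -> : A i b = rsum (fun j => if j == b then A i j else 0) by rewrite rsum_delta.
rewrite -rsumD -rsumB -rsumMr; apply: eq_rsum => j; rewrite /shift /unif.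
by case: ifP => _; case: ifP => _; case: ifP => _; lra.
Qed.

Lemma word_shift_ac a b i : a \in U -> b \in U ->
  s i = 0 -> s i + A i a - A i b = 0.
Proof.
move=> aU bU; have := le_s i aU; have := le_s i bU.
by have [? _] := A_bound i a; have [? _] := A_bound i b; lra.
Qed.

(** Expanding the square leaves a cross term proportional to [A i a - A i b], which sums to 0
    because columns sum to 1; as entries are nonnegative, [(A i a - A i b) ^ 2 <= A i a ^ 2 + A i b
    ^ 2]. *)
Lemma chi2_shift a b : a \in U -> b \in U -> a != b ->
  rsum (fun i => rsum (fun j => A i j * shift a b j) ^ 2 /
                 rsum (fun j => A i j * unif j)) <= 1 + (h a + h b) / n.
Proof.
move=> aU bU ab; have U0 : (0 < #|U|)%N by apply/card_gt0P; exists a.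
have n0 : 0 < n by apply: lt_0_INR; apply/ltP.
have in0 := Rinv_0_lt_compat _ n0.
have [[_ unif1] _ _] := sparse_unif U0.
apply: (@Rle_trans _ (rsum (fun i => rsum (fun j => A i j * unif j) +
   (2 * / n) * (A i a - A i b) + / n * (A i a ^ 2 / s i + A i b ^ 2 / s i)))); last first.
  rewrite !rsumD !rsumMl rsumB rsumD (word_sum unif1) !A_sum /h; right.
  rewrite /Rdiv; ring.
apply: rsum_le => i; rewrite word_unif word_shift.
have [A0 _] := A_bound i a; have [B0 _] := A_bound i b.
have [s0|/esym s0] := s_ge0 i; last first.
  (* In a row with [s i = 0] both entries vanish and the two sides are 0. *)
  rewrite s0 -{1}s0 (word_shift_ac aU bU s0).
  have := le_s i aU; have := le_s i bU; rewrite s0 => ? ?.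
  have -> : A i a = 0 by lra.
  have -> : A i b = 0 by lra.
  by rewrite /Rdiv; lra.
have -> : ((s i + A i a - A i b) * / n) ^ 2 / (s i * / n) =
   s i * / n + 2 * / n * (A i a - A i b) + / n * ((A i a - A i b) ^ 2 / s i).
  by field; lra.
apply: Rplus_le_compat_l; apply: Rmult_le_compat_l; first lra.
rewrite /Rdiv -Rmult_plus_distr_r; apply: Rmult_le_compat_r; last nra.
exact: inv_s_ge0.
Qed.

Lemma hard_pair (m : nat) (Alg : document m D -> {set 'I_k} -> R) :
  (1 < #|U|)%N -> 6 * INR m * (INR D * M) < INR #|U| ^ 2 -> is_algorithm Alg ->
  exists x, [/\ in_simplex x, sparse_lb #|U| x & success_prob A Alg x < 3 / 4].
Proof.
move=> U1 mU algP; have U0 := ltnW U1.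
have n0 : 0 < n by apply: lt_0_INR; apply/ltP.
have in0 := Rinv_0_lt_compat _ n0.
have [a [b [aU bU ab ha hb]]] := exists_small_pair U1.
have [unifS unifP suppU] := sparse_unif U0.
have [shiftS shiftP bshift] := sparse_shift aU bU ab.
have chi := chi2_shift aU bU ab.
set rho := rsum _ in chi.
have DM0 : 0 <= INR D * M by apply: Rmult_le_pos => //; exact: pos_INR.
have rho_lt : rho ^ m < 2.
  have n2 : 2 <= n by have := le_INR _ _ (leP U1); rewrite /n /=; lra.
  have nP : INR #|U|.-1 = n - 1 by rewrite /n -{2}(prednK U0) S_INR; lra.
  rewrite nP in hb.
  have hh : (h a + h b) / n <= 3 * (INR D * M) / n ^ 2.
    (* Uses [n <= 2 * (n - 1)]; with [n * h a <= D * M] this gives the constant 3. *)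
    have h1 : n * h b <= 2 * (INR D * M) by have := h_ge0 b; nra.
    have -> : (h a + h b) / n = (n * h a + n * h b) * / n ^ 2 by field; lra.
    apply: Rmult_le_compat_r; last by have ha' : n * h a <= INR D * M := ha; lra.
    by left; apply: Rinv_0_lt_compat; apply: pow_lt.
  have rho0 : 0 <= rho.
    apply: rsum_ge0 => i; apply: div_ge0; first exact: pow2_ge_0.
    exact: word_ge0.
  set y := 3 * (INR D * M) / n ^ 2 in hh.
  have : rho ^ m <= exp (INR m * y).
    rewrite exp_nat_mul; apply: pow_incr; split=> //.
    by have := exp_ineq1_le y; lra.
  (* The factor 6 in the hypothesis is 2 times 3. Then [exp (- (m * y)) >= 1 - m * y > 1 / 2], so
     [exp (m * y) < 2]. *)
  have my : INR m * y < / 2.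
    have n20 : 0 < n ^ 2 by apply: pow_lt.
    apply: (Rmult_lt_reg_r (n ^ 2)) => //.
    have -> : INR m * y * n ^ 2 = 3 * INR m * (INR D * M) by rewrite /y; field; lra.
    by rewrite -/n in mU; lra.
  have e1 : exp (INR m * y) * exp (- (INR m * y)) = 1.
    by rewrite -exp_plus Rplus_opp_r exp_0.
  have := exp_ineq1_le (- (INR m * y)); have := exp_pos (INR m * y); nra.
have [|||||lt|lt] := @le_cam m D k A (shift a b) unif _ _ _ _ Alg algP _ rho_lt.
- by move=> i; exact: word_ge0.
- by move=> i; exact: word_ge0.
- by apply: word_sum; case: unifS.
- move=> i; rewrite word_unif word_shift => e.
  by rewrite (word_shift_ac aU bU) ?Rmult_0_l //; nra.
- by apply: contraNneq bshift => ->; rewrite suppU.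
- by exists (shift a b).
- by exists unif.
Qed.

End HardPair.

(** * Regular instances are good *)

Section RegularGood.
Variables (D k : nat) (S : instance D k) (delta : R).
Hypotheses (D_gt0 : (0 < D)%N) (delta_ge0 : 0 <= delta) (regS : regular delta S).

Let D0 : 0 < INR D.
Proof. exact/lt_0_INR/ltP. Qed.

Let card_ge j : INR D / 4 <= INR #|S j|.
Proof. by case: regS => /(_ j) le _; lra. Qed.

Lemma Amat_bound i j : 0 <= Amat S i j <= 4 / INR D.
Proof.
have cj := card_ge j; rewrite /Amat; case: ifP => _.
  split; first by left; apply: Rinv_0_lt_compat; lra.
  have -> : 4 / INR D = / (INR D / 4) by field; lra.
  by apply: Rinv_le_contravar; lra.
by split; [right | apply: Rmult_le_pos; [lra | left; exact: Rinv_0_lt_compat]].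
Qed.

Lemma Amat_sum j : rsum ((Amat S)^~ j) = 1.
Proof.
rewrite (@eq_rsum _ _ (fun i => (if i \in S j then 1 else 0) * / INR #|S j|)) => [|i].
  by rewrite rsumMr rsum_mem; apply: Rinv_r; have := card_ge j; lra.
by rewrite /Amat; case: ifP => _; lra.
Qed.

Lemma prodBA_sgn i j :
  prodBA (fun i => sgn (S i)) (Amat S) i j = signed_overlap (S i) (S j) * / INR #|S j|.
Proof.
rewrite /prodBA -rsumMr; apply: eq_rsum => l; rewrite /Amat.
by case: ifP => _; lra.
Qed.

Lemma overlap_self (T : finType) (V : {set T}) : signed_overlap V V = INR #|V|.
Proof.
rewrite -rsum_mem; apply: eq_rsum => t; rewrite /sgn.
by case: ifP => _; lra.
Qed.

(** Off the diagonal, an overlap of at most [delta * D / 4] is divided by [#|S j| >= D / 4]; on the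
    diagonal the product is exactly 1. *)
Lemma sgn_feasible : lam_feasible (Amat S) delta (fun i => sgn (S i)).
Proof.
apply/lam_feasibleP => // i j; rewrite prodBA_sgn /kron; have cj := card_ge j.
have [->|ij] := eqVneq i j.
  by rewrite overlap_self Rinv_r ?Rminus_diag ?Rabs_R0 //; lra.
have cj0 : 0 < INR #|S j| by lra.
rewrite Rminus_0_r Rabs_mult (Rabs_pos_eq (/ _)); last by left; exact: Rinv_0_lt_compat.
have [_ /(_ i j ij) le] := regS.
apply: (Rmult_le_reg_r (INR #|S j|)) => //.
rewrite Rmult_assoc Rinv_l ?Rmult_1_r; last lra.
by apply: Rle_trans le _; nra.
Qed.

Lemma lambda_le1 : exists v, is_lambda (Amat S) delta v /\ v <= 1.
Proof.
have [v vP] := is_lambda_exists delta_ge0 (ex_intro _ _ sgn_feasible).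
exists v; split=> //; case: vP => _ /(_ _ sgn_feasible) le.
apply: Rle_trans le _; apply/maxnorm_le => [|i l]; first lra.
by rewrite /sgn; case: ifP => _; split_Rabs; lra.
Qed.

(** [U] consists of the first [r] topics. With [M = 4 / D] one has [D * M = 4], which turns the 6 of
    [hard_pair] into 24. *)
Lemma support_hard (r m : nat) (Alg : document m D -> {set 'I_k} -> R) :
  (1 < r <= k)%N -> 24 * INR m < INR r ^ 2 -> is_algorithm Alg ->
  exists x, in_simplex x /\ sparse_lb r x /\ success_prob (Amat S) Alg x < 3 / 4.
Proof.
move=> /andP [r1 rk] mr algP; pose U := [set widen_ord rk i | i : 'I_r].
have cardU : #|U| = r.
  by rewrite card_imset ?card_ord // => i j /(congr1 val) /= ?; exact: val_inj.
have DM : INR D * (4 / INR D) = 4 by field; lra.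
have M0 : 0 <= 4 / INR D by apply: Rmult_le_pos; [lra | left; exact: Rinv_0_lt_compat].
have [||x []] := hard_pair (U := U) Amat_bound M0 Amat_sum _ _ algP.
- by rewrite cardU.
- by rewrite cardU DM; lra.
- by rewrite cardU => ? ? ?; exists x.
Qed.

End RegularGood.

Lemma good_event_regular (c : R) (r D k m : nat) (S : instance D k) :
  0 <= c -> (0 < D)%N -> (1 < r <= k)%N -> 24 * INR m < INR r ^ 2 ->
  regular (c * sqrt (ln (INR k) / INR D)) S -> good_event c r D k m S.
Proof.
move=> c0 D0 rk mr reg.
have d0 : 0 <= c * sqrt (ln (INR k) / INR D).
  by apply: Rmult_le_pos => //; exact: sqrt_pos.
by split=> [|Alg]; [exact: lambda_le1 reg | exact: support_hard reg _ _ _ rk mr].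
Qed.

(** * Probability estimates and the limit *)

Lemma prob_inst_le1 (D k : nat) (E : instance D k -> Prop) : prob_inst E <= 1.
Proof.
have N0 : 0 < INR #|{: instance D k}|.
  by apply/lt_0_INR/ltP/card_gt0P; exists [ffun=> set0].
apply: (Rmult_le_reg_r _ _ _ N0); rewrite /prob_inst /Rdiv Rmult_assoc Rinv_l ?Rmult_1_r; last lra.
rewrite Rmult_1_l -[X in _ <= X]Rmult_1_r -rsum_const; apply: rsum_le => S.
by apply: indicator_le => [|_]; lra.
Qed.

Lemma prob_inst_ge (D k : nat) (E F : instance D k -> Prop) (b : R) :
  (forall S, ~ F S -> E S) ->
  rsum (fun S => indicator (F S)) <= b * INR #|{: instance D k}| ->
  1 - b <= prob_inst E.
Proof.
move=> FE Fb.
have N0 : 0 < INR #|{: instance D k}|.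
  by apply/lt_0_INR/ltP/card_gt0P; exists [ffun=> set0].
apply: (Rmult_le_reg_r _ _ _ N0); rewrite /prob_inst /Rdiv Rmult_assoc Rinv_l ?Rmult_1_r; last lra.
have : rsum (fun S => 1 - indicator (F S)) <= rsum (fun S => indicator (E S)).
  apply: rsum_le => S; have [/indicator_true->|nF] := classic (F S).
    by have := indicator_ge0 (E S); lra.
  by rewrite (indicator_false nF) indicator_true; [lra | exact: FE].
have N1 : rsum (fun _ : instance D k => 1) = INR #|{: instance D k}|.
  by rewrite rsum_const Rmult_1_r.
rewrite rsumB => le.
have scale (x y z N : R) : x - y <= z -> x = N -> y <= b * N -> (1 - b) * N <= z by lra.
exact: scale le N1 Fb.
Qed.

Lemma exp_opp_le_inv (x : R) : 0 < x -> exp (- x) <= / x.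
Proof.
move=> x0; rewrite exp_Ropp; apply: Rinv_le_contravar => //.
by have := exp_ineq1_le x; lra.
Qed.

(** Since [32 ^ 2 / 128 = 8], the overlap term is [2 * k ^ 2 * k ^ (-8) <= 2 / r]. Since
    [ln k <= D / 64], the size term is at most [exp (- D / 64) <= 64 / D <= 64 / r]. *)
Lemma failure_bound (D k r : nat) :
  (1 < r <= k)%N -> INR r <= INR D -> ln (INR k) <= INR D / 64 ->
  INR k * exp (- (INR D / 32)) + 2 * INR k ^ 2 *
    exp (- ((32 * sqrt (ln (INR k) / INR D)) ^ 2 * INR D / 128)) <= 66 / INR r.
Proof.
move=> /andP [r1 rk] rD lnk.
have r0 : 2 <= INR r by have := le_INR _ _ (leP r1); rewrite /=; lra.
have kr : INR r <= INR k by exact/le_INR/leP.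
have k0 : 0 < INR k by lra.
have lnk0 : 0 <= ln (INR k) by rewrite -ln_1; left; apply: ln_increasing; lra.
have t1 : INR k * exp (- (INR D / 32)) <= 64 / INR r.
  rewrite -{1}(exp_ln _ k0) -exp_plus.
  apply: (@Rle_trans _ (exp (- (INR D / 64)))); first by apply: exp_le; lra.
  apply: Rle_trans (exp_opp_le_inv _) _; first lra.
  have -> : / (INR D / 64) = 64 * / INR D by field; lra.
  apply: Rmult_le_compat_l; first lra.
  by apply: Rinv_le_contravar; lra.
have -> : (32 * sqrt (ln (INR k) / INR D)) ^ 2 * INR D / 128 = INR 8 * ln (INR k).
  rewrite Rpow_mult_distr pow2_sqrt; first by rewrite /=; field; lra.
  by apply: Rmult_le_pos => //; left; apply: Rinv_0_lt_compat; lra.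
have -> : exp (- (INR 8 * ln (INR k))) = (/ INR k) ^ 8.
  by rewrite exp_Ropp exp_nat_mul exp_ln // pow_inv.
have t2 : 2 * INR k ^ 2 * (/ INR k) ^ 8 <= 2 / INR r.
  have ik : 0 < / INR k by exact: Rinv_0_lt_compat.
  have -> : 2 * INR k ^ 2 * (/ INR k) ^ 8 = 2 * (/ INR k * (/ INR k) ^ 5) by field; lra.
  apply: Rmult_le_compat_l; first lra.
  have ik1 : / INR k <= 1 by rewrite -Rinv_1; apply: Rinv_le_contravar; lra.
  have p5 : (/ INR k) ^ 5 <= 1 by rewrite -(pow1 5); apply: pow_incr; lra.
  have ikr : / INR k <= / INR r by apply: Rinv_le_contravar; lra.
  by nra.
have -> : 66 / INR r = 64 / INR r + 2 / INR r by field; lra.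
lra.
Qed.

(** The asymptotic parameters are sequences in [n]. The algorithm is quantified inside the event, so
    it may depend on the random matrix. *)
Theorem theorem6p1 :
  exists c : R,
  forall (r k D m : nat -> nat),
    (forall n, (r n <= k n)%N) ->
    (forall M : nat, exists N, forall n, (N <= n)%N -> (M <= r n)%N) ->
    cv_infty (fun n => INR (D n) / (INR (r n) ^ 2)) ->
    Un_cv (fun n => ln (INR (k n)) / INR (D n)) 0 ->
    Un_cv (fun n => INR (m n) / (INR (r n) ^ 2)) 0 ->
    Un_cv (fun n => prob_inst (good_event c (r n) (D n) (k n) (m n))) 1.
Proof.
exists 32 => r k D m rk rinf Dinf lnk mr e e0.
(* Once [r >= M], the failure probability [66 / r] is below [e]. *)
have [M [Me M0]] := archimed_cor1 (e / 66) ltac:(lra).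
(* The four thresholds give [r >= max(2, M)], [D > r ^ 2], [ln k < D / 64] and [24 * m < r ^ 2]. *)
have [N1 rN] := rinf (maxn 2 M); have [N2 DN] := Dinf 1.
have [N3 kN] := lnk (/ 64) ltac:(lra); have [N4 mN] := mr (/ 24) ltac:(lra).
exists (maxn (maxn N1 N2) (maxn N3 N4)) => n nN.
have {}rN := rN n ltac:(lia); have {}DN := DN n ltac:(lia).
have {}kN := kN n ltac:(lia); have {}mN := mN n ltac:(lia).
move: {rk}(rk n) rN DN kN mN; rewrite /Rdist !Rminus_0_r.
move: (r n) (k n) (D n) (m n) => r' k' D' m' rk rM Dr lnkD mr'.
have rk1 : (1 < r' <= k')%N by lia.
have r2 : 2 <= INR r' by have := le_INR 2 r' ltac:(lia); rewrite /=; lra.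
have r20 : 0 < INR r' ^ 2 by apply: pow_lt; lra.
have Dr2 : INR r' ^ 2 < INR D'.
  have := Rmult_lt_compat_r _ _ _ r20 Dr.
  by rewrite /Rdiv Rmult_assoc Rinv_l; lra.
have rD : INR r' <= INR D' by nra.
have D0 : (0 < D')%N by apply/ltP/INR_lt; rewrite /=; lra.
have lnkD' : ln (INR k') <= INR D' / 64.
  have lt := Rle_lt_trans _ _ _ (Rle_abs _) lnkD.
  have := Rmult_lt_compat_r (INR D') _ _ ltac:(lra) lt.
  by rewrite /Rdiv Rmult_assoc Rinv_l; lra.
have mr2 : 24 * INR m' < INR r' ^ 2.
  have lt := Rle_lt_trans _ _ _ (Rle_abs _) mr'.
  have := Rmult_lt_compat_r _ _ _ r20 lt.
  by rewrite /Rdiv Rmult_assoc Rinv_l; lra.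
pose delta := 32 * sqrt (ln (INR k') / INR D').
have delta0 : 0 <= delta by have := sqrt_pos (ln (INR k') / INR D'); rewrite /delta; lra.
have ge := @prob_inst_ge D' k' (good_event 32 r' D' k' m')
  (fun S => ~ regular delta S) _ _ (@prob_not_regular D' k' D0 delta delta0).
have {}ge : 1 - 66 / INR r' <= prob_inst (good_event 32 r' D' k' m').
  apply: Rle_trans (ge _); last first.
    move=> S /NNPP reg; apply: good_event_regular => //; lra.
  by have := failure_bound rk1 rD lnkD'; rewrite -/delta; lra.
have le := prob_inst_le1 (good_event 32 r' D' k' m').
have small : 66 / INR r' < e.
  have Mpos : 0 < INR M by exact: lt_0_INR.
  have : / INR r' <= / INR M.
    by apply: Rinv_le_contravar => //; apply: le_INR; lia.
  lra.
by rewrite Rabs_minus_sym Rabs_pos_eq; lra.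
Qed.
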